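(* For all probabilistic graphs $G_1, G_2$ and all $\alpha \in (0,1)$, $$\overline{H}\big(G_1 \overset{(\alpha, 1-\alpha)}{\sqcup} G_2\big) = \alpha \overline{H}(G_1) + (1-\alpha)\overline{H}(G_2) \iff \overline{H}(G_1 \wedge G_2) = \overline{H}(G_1) + \overline{H}(G_2).$$
   Context: A probabilistic graph is a tuple $G=(\mathcal{V},\mathcal{E},P_V)$ where $(\mathcal{V},\mathcal{E})$ is a finite simple undirected graph and $P_V$ is a probability distribution on $\mathcal{V}$. AND product: $G_1\wedge G_2$ has vertex set $\mathcal{V}_1\times\mathcal{V}_2$, distribution $P_{V_1}P_{V_2}$ (product distribution), and two distinct vertices $(v_1,v_2),(v_1',v_2')$ are adjacent iff ($v_1=v_1'$ or $v_1v_1'\in\mathcal{E}_1$) and ($v_2=v_2'$ or $v_2v_2'\in\mathcal{E}_2$). $G^{\wedge n}$ is the $n$-fold AND product $G\wedge\dots\wedge G$. Disjoint union: $G_1 \overset{(\alpha,1-\alpha)}{\sqcup} G_2$ has vertex set the disjoint union of $\mathcal{V}_1$ and $\mathcal{V}_2$; two vertices are adjacent iff they lie in the same $\mathcal{V}_i$ and are adjacent in $G_i$; its distribution is $\alpha P_{V_1}+(1-\alpha)P_{V_2}$. A coloring of $G$ is a map $c$ on $\mathcal{V}$ such that adjacent vertices receive different values. The chromatic entropy is $H_\chi(G)=\inf\{H(c(V)) : c \text{ a coloring of } G\}$, where $V\sim P_V$ and $H$ is Shannon entropy (logarithms in base 2). The complementary graph entropy is $\overline{H}(G)=\lim_{n\to\infty}\frac1n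 H_\chi(G^{\wedge n})$ (the limit exists). *)

(* Defs.v *)
From HB Require Import structures.
From mathcomp Require Import all_boot all_order all_algebra.
From mathcomp Require Import all_classical all_reals all_analysis.

Set Implicit Arguments.
Unset Strict Implicit.
Unset Printing Implicit Defensive.

Import Order.TTheory GRing.Theory Num.Theory.
Import numFieldNormedType.Exports.

Local Open Scope classical_set_scope.
Local Open Scope ring_scope.

(* [dist] may vanish on some vertices; such vertices still constrain
   colorings. *)
Record pgraph (R : realType) := PGraph {
  vertex : finType;
  adj : rel vertex;
  dist : vertex -> R;
  adj_sym : symmetric adj;
  adj_irr : irreflexive adj;
  dist_ge0 : forall v, 0 <= dist v;
  dist_sum1 : \sum_v dist v = 1
}.

Section AndProduct.
Variables (R : realType) (G1 G2 : pgraph R).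

Definition and_adj : rel (vertex G1 * vertex G2)%type := fun u v =>
  [&& u != v, (u.1 == v.1) || adj u.1 v.1 & (u.2 == v.2) || adj u.2 v.2].

Definition and_dist (u : (vertex G1 * vertex G2)%type) : R :=
  dist u.1 * dist u.2.

Lemma and_adj_sym : symmetric and_adj.
Proof.
move=> u v; rewrite /and_adj eq_sym (eq_sym u.1) (eq_sym u.2).
by rewrite (adj_sym u.1) (adj_sym u.2).
Qed.

Lemma and_adj_irr : irreflexive and_adj.
Proof. by move=> u; rewrite /and_adj eqxx. Qed.

Lemma and_dist_ge0 u : 0 <= and_dist u.
Proof. by rewrite mulr_ge0 ?dist_ge0. Qed.

Lemma and_dist_sum1 : \sum_u and_dist u = 1.
Proof.
rewrite -(pair_bigA _ (fun x y => dist x * dist y)) /=.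
under eq_bigr do rewrite -mulr_sumr dist_sum1 mulr1.
exact: dist_sum1.
Qed.

Definition and_prod : pgraph R :=
  PGraph and_adj_sym and_adj_irr and_dist_ge0 and_dist_sum1.

End AndProduct.

(* [and_pow G n] is ((G /\ G) /\ ...) /\ G with n factors for 0 < n; the value
   at n = 0 is irrelevant. *)
Definition and_pow (R : realType) (G : pgraph R) (n : nat) : pgraph R :=
  iter n.-1 (fun H => and_prod H G) G.

Section DisjointUnion.
Variables (R : realType) (a : R) (ha : 0 < a < 1) (G1 G2 : pgraph R).

Definition union_adj : rel (vertex G1 + vertex G2)%type := fun u v =>
  match u, v with
  | inl u1, inl v1 => adj u1 v1
  | inr u2, inr v2 => adj u2 v2
  | _, _ => false
  end.

Definition union_dist (u : (vertex G1 + vertex G2)%type) : R :=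
  match u with
  | inl u1 => a * dist u1
  | inr u2 => (1 - a) * dist u2
  end.

Lemma union_adj_sym : symmetric union_adj.
Proof. by move=> [u|u] [v|v] //=; rewrite adj_sym. Qed.

Lemma union_adj_irr : irreflexive union_adj.
Proof. by move=> [u|u] /=; rewrite adj_irr. Qed.

Lemma union_dist_ge0 u : 0 <= union_dist u.
Proof.
have /andP[a0 a1] := ha.
by case: u => v /=; rewrite mulr_ge0 ?dist_ge0 ?subr_ge0 // ltW.
Qed.

Lemma union_dist_sum1 : \sum_u union_dist u = 1.
Proof. by rewrite big_sumType /= -!mulr_sumr !dist_sum1 !mulr1 addrC subrK. Qed.

Definition disj_union : pgraph R :=
  PGraph union_adj_sym union_adj_irr union_dist_ge0 union_dist_sum1.

End DisjointUnion.

Definition log2 (R : realType) (x : R) : R := ln x / ln 2.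

(* The convention 0 log 0 = 0 holds because of the factor p x. *)
Definition entropy (R : realType) (T : finType) (p : T -> R) : R :=
  - \sum_x p x * log2 (p x).

Definition law (R : realType) (G : pgraph R) (C : finType)
    (c : vertex G -> C) (x : C) : R :=
  \sum_(v | c v == x) dist v.

Definition coloring (R : realType) (G : pgraph R) (C : finType)
    (c : vertex G -> C) : Prop :=
  forall u v, adj u v -> c u != c v.

(* Arbitrary color sets reduce to finite ones since [vertex G] is finite. *)
Definition chromatic_entropy (R : realType) (G : pgraph R) : R :=
  inf [set h : R | exists (C : finType) (c : vertex G -> C),
                     coloring c /\ h = entropy (law c)].

Definition compl_entropy (R : realType) (G : pgraph R) : R :=
  lim ((fun n : nat => chromatic_entropy (and_pow G n) / n%:R) @ \oo).

(* Main.v *)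
Require Import Defs.
From mathcomp Require Import all_boot all_order all_algebra.
From mathcomp Require Import all_classical all_reals all_analysis.
From mathcomp Require Import ring lra zify.

Set Implicit Arguments.
Unset Strict Implicit.
Unset Printing Implicit Defensive.

Import Order.TTheory GRing.Theory Num.Theory.
Import numFieldNormedType.Exports.

Local Open Scope classical_set_scope.
Local Open Scope ring_scope.

(** Write [h k l] for the chromatic entropy of [G1^k /\ G2^l] and [U] for the
    disjoint union.  The words of [U^n] split into mutually non-adjacent
    components according to their pattern in {1,2}^n; coloring all patterns of
    the same type alike shows that the chromatic entropy of [U^n] is
    [E h(K, n - K)], with [K] binomial of parameters [n] and [a], up to
    [log2 (n + 1)].  Subadditivity of [h] then gives, with A, B, S, H the
    complementary entropies of [G1], [G2], [G1 /\ G2], [U]: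
    - H <= a A + (1 - a) B - a (1 - a) (A + B - S), by splitting [h k l] into a
      diagonal part [h m m], m = min k l >= k l / n, and two one-sided parts;
    - S <= H + (1 - a) A + a B, by h(n, n) <= h(K, n - K) + h(n - K, K).
    Both directions follow from these two inequalities and S <= A + B.  Only
    first and mixed second moments of [K] are needed, and no concentration. *)

(** * Base-2 logarithm and Gibbs' inequality *)

Lemma ln2_gt0 (R : realType) : 0 < ln 2 :> R.
Proof. by rewrite ln_gt0 // ltr1n. Qed.

Lemma log2M (R : realType) (x y : R) :
  0 < x -> 0 < y -> log2 (x * y) = log2 x + log2 y.
Proof. by move=> x0 y0; rewrite /log2 lnM ?posrE// mulrDl. Qed.

Lemma ler_log2 (R : realType) (x y : R) : 0 < x -> x <= y -> log2 x <= log2 y.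
Proof.
move=> x0 xy; rewrite /log2 ler_pM2r ?invr_gt0 ?ln2_gt0//.
by rewrite ler_ln ?posrE// (lt_le_trans x0).
Qed.

Lemma log2_le0 (R : realType) (x : R) : x <= 1 -> log2 x <= 0.
Proof.
by move=> x1; rewrite /log2 pmulr_lle0 ?invr_gt0 ?ln2_gt0// ln_le0.
Qed.

(** Sum [ln t <= t - 1] at [t = r x / p x], weighted by [p x]. The support condition excludes
    [r x = 0 < p x], where the default value [ln 0 = 0] would stand in for an infinite cross
    entropy. *)
Lemma gibbs (R : realType) (T : finType) (p r : T -> R) :
  (forall x, 0 <= p x) -> (forall x, 0 <= r x) ->
  \sum_x r x <= \sum_x p x -> (forall x, r x = 0 -> p x = 0) ->
  entropy p <= - \sum_x p x * log2 (r x).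
Proof.
move=> p0 r0 rp rp0; rewrite /entropy lerN2 -subr_ge0 -sumrB.
have -> : \sum_x (p x * log2 (p x) - p x * log2 (r x)) =
    (\sum_x (p x * ln (p x) - p x * ln (r x))) / ln 2.
  by rewrite mulr_suml; apply: eq_bigr => x _; rewrite /log2 mulrBl !mulrA.
rewrite divr_ge0 ?(ltW (ln2_gt0 R))//.
apply: (@le_trans _ _ (\sum_x (p x - r x))).
  by rewrite sumrB subr_ge0.
apply: ler_sum => x _.
have [->|px] := eqVneq (p x) 0; first by rewrite !mul0r subrr sub0r oppr_le0.
have px0 : 0 < p x by rewrite lt_neqAle eq_sym px p0.
have rx0 : 0 < r x.
  by rewrite lt_neqAle r0 eq_sym andbT; apply: contra_neq px; exact: rp0.
have H : ln (r x / p x) <= r x / p x - 1.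
  have := @le_ln1Dx R (r x / p x - 1); rewrite (addrC 1) subrK; apply.
  by rewrite ltrBrDr addNr divr_gt0.
move: H; rewrite ln_div ?posrE// => /(ler_wpM2l (p0 x)).
have -> : p x * (r x / p x - 1) = r x - p x by field.
lra.
Qed.

(** * Color laws, their entropy, and the infimum over colorings *)

Lemma law_ge0 (R : realType) (G : pgraph R) (C : finType) (c : vertex G -> C) x :
  0 <= law c x.
Proof. by apply: sumr_ge0 => v _; exact: dist_ge0. Qed.

Lemma sum_law (R : realType) (G : pgraph R) (C : finType) (c : vertex G -> C) :
  \sum_x law c x = 1.
Proof.
rewrite -(@dist_sum1 _ G) (partition_big c predT)//=.
Qed.

Lemma law_le1 (R : realType) (G : pgraph R) (C : finType) (c : vertex G -> C) x :
  law c x <= 1.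
Proof.
rewrite -(sum_law c) (bigD1 x)//= lerDl.
by apply: sumr_ge0 => y _; exact: law_ge0.
Qed.

Lemma sum_law_mul (R : realType) (G : pgraph R) (C : finType)
    (c : vertex G -> C) (F : C -> R) :
  \sum_x law c x * F x = \sum_v dist v * F (c v).
Proof.
rewrite [RHS](partition_big c predT)//=; apply: eq_bigr => x _.
by rewrite /law mulr_suml; apply: eq_bigr => v /eqP ->.
Qed.

Lemma law_indicator (R : realType) (G : pgraph R) (C : finType)
    (c : vertex G -> C) x :
  law c x = \sum_v dist v * (c v == x)%:R.
Proof.
rewrite /law big_mkcond; apply: eq_bigr => v _.
by case: eqP; rewrite ?mulr1 ?mulr0.
Qed.

Lemma entropy_law (R : realType) (G : pgraph R) (C : finType)
    (c : vertex G -> C) :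
  entropy (law c) = - \sum_v dist v * log2 (law c (c v)).
Proof. by rewrite /entropy sum_law_mul. Qed.

Lemma dist_le_law (R : realType) (G : pgraph R) (C : finType)
    (c : vertex G -> C) v :
  dist v <= law c (c v).
Proof.
by rewrite /law (bigD1 v)//= lerDl; apply: sumr_ge0 => u _; exact: dist_ge0.
Qed.

Lemma entropy_law_ge0 (R : realType) (G : pgraph R) (C : finType)
    (c : vertex G -> C) :
  0 <= entropy (law c).
Proof.
rewrite /entropy -sumrN; apply: sumr_ge0 => x _.
by rewrite -mulrN mulr_ge0 ?law_ge0// oppr_ge0 log2_le0// law_le1.
Qed.

Lemma entropy_law_inj (R : realType) (G : pgraph R) (C D : finType)
    (c : vertex G -> C) (f : C -> D) :
  injective f -> entropy (law (f \o c)) = entropy (law c).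
Proof.
move=> fI; rewrite !entropy_law; congr (- _); apply: eq_bigr => v _.
by congr (_ * log2 _); apply: eq_bigl => u /=; rewrite (inj_eq fI).
Qed.

Lemma chromatic_entropy_le (R : realType) (G : pgraph R) (C : finType)
    (c : vertex G -> C) :
  coloring c -> chromatic_entropy G <= entropy (law c).
Proof.
move=> cc; apply: ge_inf; last by exists C, c.
by exists 0 => _ [D [d [_ ->]]]; exact: entropy_law_ge0.
Qed.

Lemma entropy_set_nonempty (R : realType) (G : pgraph R) :
  [set h : R | exists (C : finType) (c : vertex G -> C),
    coloring c /\ h = entropy (law c)] !=set0.
Proof.
exists (entropy (law (@id (vertex G)))), (vertex G), id; split => // u v uv.
by apply/eqP => uv'; rewrite uv' adj_irr in uv.
Qed.

Lemma le_chromatic_entropy (R : realType) (G : pgraph R) (h : R) :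
  (forall (C : finType) (c : vertex G -> C), coloring c -> h <= entropy (law c))
  -> h <= chromatic_entropy G.
Proof.
move=> H; apply: lb_le_inf; first exact: entropy_set_nonempty.
by move=> _ [C [c [cc ->]]]; exact: H.
Qed.

Lemma chromatic_entropy_ge0 (R : realType) (G : pgraph R) :
  0 <= chromatic_entropy G.
Proof. by apply: le_chromatic_entropy => C c _; exact: entropy_law_ge0. Qed.

(** Allowing every palette ['I_M] with [M] large lets colorings of finitely many graphs share one
    type of colors. *)
Lemma near_optimal_coloring (R : realType) (G : pgraph R) (e : R) : 0 < e ->
  exists2 m : nat, (0 < m)%N & forall M, (m <= M)%N ->
    exists2 c : vertex G -> 'I_M,
      coloring c & entropy (law c) < chromatic_entropy G + e.
Proof.
move=> e0.
have [|_ [C [c [cc ->]]] He] := inf_adherent e0 (conj (@entropy_set_nonempty R G) _).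
  by exists 0 => _ [D [d [_ ->]]]; exact: entropy_law_ge0.
exists #|C|.+1 => // M CM.
pose f (x : C) : 'I_M := widen_ord (ltnW CM) (enum_rank x).
have fI : injective f.
  by move=> x y /(congr1 val)/= /val_inj; exact: enum_rank_inj.
exists (f \o c); last by rewrite entropy_law_inj.
by move=> u v uv /=; rewrite (inj_eq fI); exact: cc.
Qed.

(** * Chromatic entropy of products and disjoint unions *)

(** Color a pair of vertices by the pair of their colors: the two colors are independent, so their
    entropies add. *)
Lemma chromatic_entropy_and (R : realType) (G H : pgraph R) :
  chromatic_entropy (and_prod G H) <= chromatic_entropy G + chromatic_entropy H.
Proof.
rewrite -lerBlDr; apply: le_chromatic_entropy => C c cc.
rewrite lerBlDr -lerBlDl; apply: le_chromatic_entropy => D d dd.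
rewrite lerBlDl.
pose cd (u : vertex (and_prod G H)) := (c u.1, d u.2).
have cdc : coloring cd.
  move=> [u1 u2] [v1 v2] /and3P[/= ne /orP A1 /orP A2].
  rewrite xpair_eqE negb_and.
  case: A1 => [/eqP E1|/cc ->//].
  case: A2 => [/eqP E2|/dd ->]; last by rewrite orbT.
  by rewrite E1 E2 eqxx in ne.
apply: (le_trans (chromatic_entropy_le cdc)).
have lawE u v : law cd (u, v) = law c u * law d v.
  rewrite /law mulr_suml.
  under [RHS]eq_bigr do rewrite mulr_sumr.
  rewrite pair_big/=.
  by apply: eq_bigl => -[x y]; rewrite xpair_eqE.
rewrite !entropy_law -opprD lerN2.
suff -> : \sum_v dist v * log2 (law cd (cd v)) =
   \sum_u \sum_v (dist u * dist v * log2 (law c (c u)) +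
                  dist u * dist v * log2 (law d (d v))).
  under [leRHS]eq_bigr do rewrite big_split/=.
  rewrite big_split/= lerD//.
    apply: ler_sum => u _.
    under eq_bigr do rewrite mulrAC.
    by rewrite -mulr_sumr dist_sum1 mulr1.
  rewrite exchange_big/=; apply: ler_sum => v _.
  under eq_bigr do rewrite -mulrA.
  by rewrite -mulr_suml dist_sum1 mul1r.
rewrite pair_bigA/=; apply: eq_bigr => -[u v] _ /=.
rewrite lawE /= /and_dist/= -mulrDr.
(* Null vertices contribute 0; at the others both color laws are positive, as [log2M] requires. *)
have [->|u0] := eqVneq (dist u) 0; first by rewrite !mul0r.
have [->|v0] := eqVneq (dist v) 0; first by rewrite mulr0 !mul0r.
by rewrite log2M// (lt_le_trans _ (dist_le_law _ _))// lt_neqAle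
  eq_sym ?u0 ?v0 dist_ge0.
Qed.

Lemma sum_disj_union (R : realType) (a : R) (ha : 0 < a < 1)
    (G1 G2 : pgraph R) (F : vertex G1 + vertex G2 -> R) :
  \sum_(v : vertex (disj_union ha G1 G2)) dist v * F v =
  a * (\sum_v dist v * F (inl v)) + (1 - a) * (\sum_v dist v * F (inr v)).
Proof.
rewrite [LHS]big_sumType/= !mulr_sumr.
by congr (_ + _); apply: eq_bigr => v _; rewrite mulrA.
Qed.

(** This is concavity of entropy: a coloring of the union restricts to colorings of both parts, and
    its law is the mixture of theirs. Gibbs' inequality bounds the entropy of each part by its cross
    entropy against the mixture. *)
Lemma chromatic_entropy_disj_union_ge (R : realType) (a : R)
    (ha : 0 < a < 1) (G1 G2 : pgraph R) :
  a * chromatic_entropy G1 + (1 - a) * chromatic_entropy G2 <=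
  chromatic_entropy (disj_union ha G1 G2).
Proof.
have /andP[a0 a1] := ha; have b0 : 0 < 1 - a by rewrite subr_gt0.
apply: le_chromatic_entropy => C c cc.
have lawE x : law c x = a * law (fun v => c (inl v)) x
                      + (1 - a) * law (fun v => c (inr v)) x.
  rewrite !law_indicator.
  exact: (sum_disj_union ha (fun v => (c v == x)%:R)).
have H1 : chromatic_entropy G1 <= - \sum_x law (fun v => c (inl v)) x * log2 (law c x).
  apply: (@le_trans _ _ (entropy (law (fun v => c (inl v))))).
    by apply: chromatic_entropy_le => u v uv; exact: cc.
  apply: gibbs; rewrite ?sum_law//; try by move=> x; exact: law_ge0.
  move=> x; rewrite lawE => /eqP.
  rewrite paddr_eq0 ?mulr_ge0 ?law_ge0 ?(ltW a0) ?(ltW b0)//.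
  by rewrite mulf_eq0 (gt_eqF a0)/= => /andP[/eqP].
have H2 : chromatic_entropy G2 <= - \sum_x law (fun v => c (inr v)) x * log2 (law c x).
  apply: (@le_trans _ _ (entropy (law (fun v => c (inr v))))).
    by apply: chromatic_entropy_le => u v uv; exact: cc.
  apply: gibbs; rewrite ?sum_law//; try by move=> x; exact: law_ge0.
  move=> x; rewrite lawE => /eqP.
  rewrite paddr_eq0 ?mulr_ge0 ?law_ge0 ?(ltW a0) ?(ltW b0)//.
  by rewrite !mulf_eq0 (gt_eqF b0)/= => /andP[_ /eqP].
apply: (le_trans (lerD (ler_wpM2l (ltW a0) H1) (ler_wpM2l (ltW b0) H2))).
rewrite !mulrN -opprD lerN2 /entropy !mulr_sumr -big_split/=.
by apply: ler_sum => x _; rewrite [a * _]mulrA [(1 - a) * _]mulrA -mulrDl -lawE.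
Qed.

(** * Isomorphisms of probabilistic graphs *)

Definition adjeq (R : realType) (G : pgraph R) (u v : vertex G) : bool :=
  (u == v) || adj u v.

Lemma adj_adjeq (R : realType) (G : pgraph R) (u v : vertex G) :
  adj u v = (u != v) && adjeq u v.
Proof. by rewrite /adjeq; case: eqVneq => [->|//]; rewrite adj_irr. Qed.

Lemma adjeq_and (R : realType) (G H : pgraph R) (u v : vertex (and_prod G H)) :
  adjeq u v = adjeq u.1 v.1 && adjeq u.2 v.2.
Proof.
rewrite {1}/adjeq [adj u v]/(and_adj u v) /and_adj.
by case: eqVneq => [->|//]; rewrite /adjeq !eqxx.
Qed.

(** For a bijection, preserving [adjeq] amounts to preserving [adj]. The reflexive relation is
    preferred because on AND products it is a plain componentwise conjunction. *)
Definition giso (R : realType) (G H : pgraph R) : Prop :=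
  exists f : vertex G -> vertex H,
    [/\ bijective f, forall u v, adjeq (f u) (f v) = adjeq u v
      & forall v, dist (f v) = dist v].

Lemma giso_refl (R : realType) (G : pgraph R) : giso G G.
Proof. by exists id; split => //; exists id. Qed.

Lemma giso_trans (R : realType) (G H K : pgraph R) :
  giso G H -> giso H K -> giso G K.
Proof.
move=> [f [fb fa fd]] [g [gb ga gd]]; exists (g \o f); split => [|u v|v] /=.
- exact: bij_comp.
- by rewrite ga fa.
- by rewrite gd fd.
Qed.

Lemma giso_sym (R : realType) (G H : pgraph R) : giso G H -> giso H G.
Proof.
move=> [f [[g fK gK] fa fd]]; exists g; split => [|u v|v].
- by exists f.
- by rewrite -fa !gK.
- by rewrite -fd gK.
Qed.

Lemma giso_and (R : realType) (G G' H H' : pgraph R) :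
  giso G G' -> giso H H' -> giso (and_prod G H) (and_prod G' H').
Proof.
move=> [f [[f' fK f'K] fa fd]] [g [[g' gK g'K] ga gd]].
exists (fun u : vertex (and_prod G H) => (f u.1, g u.2) : vertex (and_prod G' H')).
split => [|u v|v].
- exists (fun u => (f' u.1, g' u.2)) => -[x y] /=; first by rewrite fK gK.
  by rewrite f'K g'K.
- by rewrite !adjeq_and /= fa ga.
- by rewrite /= /and_dist/= fd gd.
Qed.

Lemma giso_andC (R : realType) (G H : pgraph R) :
  giso (and_prod G H) (and_prod H G).
Proof.
exists (fun u : vertex (and_prod G H) => (u.2, u.1) : vertex (and_prod H G)).
split => [|u v|v].
- by exists (fun u => (u.2, u.1)) => -[].
- by rewrite !adjeq_and andbC.
- by rewrite /= /and_dist mulrC.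
Qed.

Lemma giso_andACA (R : realType) (G H K L : pgraph R) :
  giso (and_prod (and_prod G H) (and_prod K L))
       (and_prod (and_prod G K) (and_prod H L)).
Proof.
exists (fun u : vertex (and_prod (and_prod G H) (and_prod K L)) =>
  ((u.1.1, u.2.1), (u.1.2, u.2.2))
    : vertex (and_prod (and_prod G K) (and_prod H L))).
split => [|u v|v].
- by exists (fun u => ((u.1.1, u.2.1), (u.1.2, u.2.2))) => -[[? ?] [? ?]].
- by rewrite !adjeq_and/= andbACA.
- by rewrite /= /and_dist/= /and_dist/= mulrACA.
Qed.

Lemma giso_andA (R : realType) (G H K : pgraph R) :
  giso (and_prod G (and_prod H K)) (and_prod (and_prod G H) K).
Proof.
exists (fun u : vertex (and_prod G (and_prod H K)) =>
  ((u.1, u.2.1), u.2.2) : vertex (and_prod (and_prod G H) K)).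
split => [|u v|v].
- by exists (fun u => (u.1.1, (u.1.2, u.2))) => [[? [? ?]]|[[? ?] ?]].
- by rewrite !adjeq_and/= andbA.
- by rewrite /= /and_dist/= /and_dist/= mulrA.
Qed.

Lemma chromatic_entropy_giso_le (R : realType) (G H : pgraph R) :
  giso G H -> chromatic_entropy G <= chromatic_entropy H.
Proof.
move=> [f [fb fa fd]]; apply: le_chromatic_entropy => C c cc.
apply: (@le_trans _ _ (entropy (law (c \o f)))).
  apply: chromatic_entropy_le => u v uv; apply: cc.
  by move: uv; rewrite !adj_adjeq fa (inj_eq (bij_inj fb)).
rewrite le_eqVlt; apply/orP; left; apply/eqP; congr entropy.
apply/funext => x; rewrite /law [RHS](reindex f)/=; last exact: onW_bij.
by apply: eq_bigr => v _; rewrite fd.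
Qed.

Lemma chromatic_entropy_giso (R : realType) (G H : pgraph R) :
  giso G H -> chromatic_entropy G = chromatic_entropy H.
Proof.
move=> GH; apply/eqP.
by rewrite eq_le !chromatic_entropy_giso_le//; exact: giso_sym.
Qed.

(** * Powers and mixed powers *)

Definition unit_pgraph (R : realType) : pgraph R.
Proof.
refine (@PGraph R unit (fun _ _ => false) (fun _ => 1) _ _ _ _) => //.
by rewrite sumr_const card_unit.
Defined.

Lemma giso_and_unit (R : realType) (G : pgraph R) :
  giso G (and_prod G (unit_pgraph R)).
Proof.
exists (fun u => (u, tt) : vertex (and_prod G (unit_pgraph R))).
split => [|u v|v].
- by exists fst => // -[? []].
- by rewrite adjeq_and/= /adjeq/= andbT.
- by rewrite /= /and_dist/= mulr1.
Qed.

(** Unlike [and_pow], this starts from the neutral graph, so that exponents add from 0 on; the two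
    agree up to isomorphism for positive exponents. *)
Definition gpow (R : realType) (G : pgraph R) (n : nat) : pgraph R :=
  iter n (and_prod G) (unit_pgraph R).

Lemma giso_and_pow (R : realType) (G : pgraph R) n :
  giso (and_pow G n.+1) (gpow G n.+1).
Proof.
elim: n => [|n IH]; first exact: giso_and_unit.
apply: giso_trans (giso_andC _ _) _.
by apply: giso_and => //; exact: giso_refl.
Qed.

Lemma giso_gpowD (R : realType) (G : pgraph R) m n :
  giso (gpow G (m + n)) (and_prod (gpow G m) (gpow G n)).
Proof.
elim: m => [|m IH].
  exact: giso_trans (giso_and_unit _) (giso_andC _ _).
apply: giso_trans (giso_andA _ _ _).
by apply: giso_and => //; exact: giso_refl.
Qed.

Lemma giso_gpow_and (R : realType) (G H : pgraph R) n :
  giso (gpow (and_prod G H) n) (and_prod (gpow G n) (gpow H n)).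
Proof.
elim: n => [|n IH]; first exact: giso_and_unit.
apply: giso_trans (giso_andACA _ _ _ _).
by apply: giso_and => //; exact: giso_refl.
Qed.

Definition mixed_pow (R : realType) (G1 G2 : pgraph R) (k l : nat) : pgraph R :=
  and_prod (gpow G1 k) (gpow G2 l).

Definition mixed_entropy (R : realType) (G1 G2 : pgraph R) (k l : nat) : R :=
  chromatic_entropy (mixed_pow G1 G2 k l).

Lemma mixed_entropyD (R : realType) (G1 G2 : pgraph R) k l k' l' :
  mixed_entropy G1 G2 (k + k') (l + l') <=
  mixed_entropy G1 G2 k l + mixed_entropy G1 G2 k' l'.
Proof.
apply: le_trans (chromatic_entropy_and _ _).
apply: chromatic_entropy_giso_le.
apply: giso_trans (giso_andACA _ _ _ _).
by apply: giso_and; exact: giso_gpowD.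
Qed.

Lemma giso_mixed_pow0 (R : realType) (G1 G2 : pgraph R) k :
  giso (gpow G1 k) (mixed_pow G1 G2 k 0).
Proof. exact: giso_and_unit. Qed.

Lemma giso_mixed_0pow (R : realType) (G1 G2 : pgraph R) l :
  giso (gpow G2 l) (mixed_pow G1 G2 0 l).
Proof. exact: giso_trans (giso_and_unit _) (giso_andC _ _). Qed.

(** The AND product distributes over the disjoint union. Peeling off one letter of the word and
    moving it to the matching mixed factor is the induction step for both bounds on the powers of
    the union. *)
Lemma giso_split (R : realType) (a : R) (ha : 0 < a < 1) (G1 G2 : pgraph R) n k l :
  let U := disj_union ha G1 G2 in
  giso (and_prod (gpow U n.+1) (mixed_pow G1 G2 k l))
       (disj_union ha (and_prod (gpow U n) (mixed_pow G1 G2 k.+1 l))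
                      (and_prod (gpow U n) (mixed_pow G1 G2 k l.+1))).
Proof.
move=> U; rewrite /mixed_pow /=.
set W := gpow U n; set X := gpow G1 k; set Y := gpow G2 l.
set A := and_prod _ _; set B := disj_union _ _ _.
pose f (u : vertex A) : vertex B :=
  match u.1.1 with
  | inl g => inl (u.1.2, ((g, u.2.1), u.2.2))
  | inr g => inr (u.1.2, (u.2.1, (g, u.2.2)))
  end.
pose g (u : vertex B) : vertex A :=
  match u with
  | inl v => ((inl v.2.1.1, v.1), (v.2.1.2, v.2.2))
  | inr v => ((inr v.2.2.1, v.1), (v.2.1, v.2.2.2))
  end.
have adjeq_inl (G H : pgraph R) (x y : vertex G) :
    @adjeq R (disj_union ha G H) (inl x) (inl y) = adjeq x y.
  by rewrite /adjeq/=.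
have adjeq_inr (G H : pgraph R) (x y : vertex H) :
    @adjeq R (disj_union ha G H) (inr x) (inr y) = adjeq x y.
  by rewrite /adjeq/=.
exists f; split.
- by exists g => [[[[?|?] ?] [? ?]]|[[? [[? ?] ?]]|[? [? [? ?]]]]].
- move=> [[[u1|u1] w] [x y]] [[[u1'|u1'] w'] [x' y']]; rewrite /f/=.
  + rewrite adjeq_inl !adjeq_and/= adjeq_inl.
    by do !case: adjeq.
  (* Letters from different sides of the union are neither equal nor adjacent. *)
  + by transitivity false => //; rewrite !adjeq_and.
  + by transitivity false => //; rewrite !adjeq_and.
  + rewrite adjeq_inr !adjeq_and/= adjeq_inr.
    by do !case: adjeq.
- move=> [[[u1|u1] w] [x y]]; rewrite /f/= /and_dist/= /and_dist/= /and_dist/=; ring.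
Qed.

(** * Binomial expectations and the chromatic entropy of powers of the union *)

(* [bexp a n F k l] is the expectation of [F (k + K) (l + n - K)] where [K] is
   binomial of parameters [n] and [a]. *)
Fixpoint bexp (R : realType) (a : R) (n : nat) (F : nat -> nat -> R)
    (k l : nat) : R :=
  if n is m.+1 then a * bexp a m F k.+1 l + (1 - a) * bexp a m F k l.+1
  else F k l.

(** Each of the [n] steps raises [k + l] by one, so only pairs on one antidiagonal are reached; this
    admits bounds that depend on [n]. *)
Lemma ler_bexp (R : realType) (a : R) (ha : 0 < a < 1) n (F H : nat -> nat -> R) k l :
  (forall k' l', (k' + l' = n + k + l)%N -> F k' l' <= H k' l') ->
  bexp a n F k l <= bexp a n H k l.
Proof.
have /andP[a0 a1] := ha; have b0 : 0 <= 1 - a by rewrite subr_ge0 ltW.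
elim: n k l => [|n IH] k l FH /=; first by apply: FH.
apply: lerD; apply: ler_wpM2l => //; try exact: ltW;
  by apply: IH => k' l' E; apply: FH; lia.
Qed.

Lemma eq_bexp (R : realType) (a : R) n (F H : nat -> nat -> R) k l :
  (forall k' l', (k' + l' = n + k + l)%N -> F k' l' = H k' l') ->
  bexp a n F k l = bexp a n H k l.
Proof.
elim: n k l => [|n IH] k l FH /=; first by apply: FH.
by rewrite !IH// => k' l' E; apply: FH; lia.
Qed.

Lemma bexpD (R : realType) (a : R) n (F H : nat -> nat -> R) k l :
  bexp a n (fun k l => F k l + H k l) k l = bexp a n F k l + bexp a n H k l.
Proof. by elim: n k l => [//|n IH] k l /=; rewrite !IH; ring. Qed.

Lemma bexpZ (R : realType) (a x : R) n (F : nat -> nat -> R) k l :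
  bexp a n (fun k l => x * F k l) k l = x * bexp a n F k l.
Proof. by elim: n k l => [//|n IH] k l /=; rewrite !IH; ring. Qed.

Lemma bexp_cst (R : realType) (a x : R) n k l :
  bexp a n (fun _ _ => x) k l = x.
Proof. by elim: n k l => [//|n IH] k l /=; rewrite !IH; ring. Qed.

Lemma bexp_fst (R : realType) (a : R) n k l :
  bexp a n (fun k _ => k%:R) k l = k%:R + n%:R * a.
Proof.
elim: n k l => [|n IH] k l /=; first by rewrite mul0r addr0.
by rewrite !IH -!natr1; ring.
Qed.

Lemma bexp_snd (R : realType) (a : R) n k l :
  bexp a n (fun _ l => l%:R) k l = l%:R + n%:R * (1 - a).
Proof.
elim: n k l => [|n IH] k l /=; first by rewrite mul0r addr0.
by rewrite !IH -!natr1; ring.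
Qed.

(** The subtracted term comes from the covariance of [K] and [n - K], which is minus the variance of
    [K]. *)
Lemma bexp_mul (R : realType) (a : R) n k l :
  bexp a n (fun k l => k%:R * l%:R) k l =
  (k%:R + n%:R * a) * (l%:R + n%:R * (1 - a)) - n%:R * a * (1 - a).
Proof.
elim: n k l => [|n IH] k l /=; first by rewrite !mul0r !addr0 subr0.
by rewrite !IH -!natr1; ring.
Qed.

(** Each letter peeled off by [giso_split] costs one use of concavity, following the recursion of
    [bexp]. *)
Lemma bexp_le_chromatic_entropy (R : realType) (a : R) (ha : 0 < a < 1)
    (G1 G2 : pgraph R) n k l :
  bexp a n (mixed_entropy G1 G2) k l <=
  chromatic_entropy (and_prod (gpow (disj_union ha G1 G2) n) (mixed_pow G1 G2 k l)).
Proof.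
have /andP[a0 a1] := ha; have b0 : 0 <= 1 - a by rewrite subr_ge0 ltW.
elim: n k l => [|n IH] k l /=.
  apply: chromatic_entropy_giso_le.
  exact: giso_trans (giso_and_unit _) (giso_andC _ _).
rewrite (chromatic_entropy_giso (giso_split ha G1 G2 n k l)).
apply: le_trans (chromatic_entropy_disj_union_ge _ _ _).
by apply: lerD; apply: ler_wpM2l => //; exact: ltW.
Qed.

Lemma sum_giso (R : realType) (G H : pgraph R) (f : vertex G -> vertex H)
    (F : vertex H -> R) :
  bijective f -> (forall v, dist (f v) = dist v) ->
  \sum_v dist v * F (f v) = \sum_v dist v * F v.
Proof.
move=> fb fd; rewrite [RHS](reindex f)/=; last exact: onW_bij.
by apply: eq_bigr => v _; rewrite fd.
Qed.

(* Words of the same type share one coloring, and different types may even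
   share colors since their words are not adjacent. *)
Lemma mixture_coloring (R : realType) (a : R) (ha : 0 < a < 1)
    (G1 G2 : pgraph R) (T : finType) n k l
    (c : forall k l, vertex (mixed_pow G1 G2 k l) -> T) :
  (forall k' l', (k' + l' = n + k + l)%N -> coloring (@c k' l')) ->
  exists2 d : vertex (and_prod (gpow (disj_union ha G1 G2) n)
                               (mixed_pow G1 G2 k l)) -> T,
    coloring d &
    forall F : T -> R, \sum_v dist v * F (d v) =
      bexp a n (fun k l => \sum_v dist v * F (@c k l v)) k l.
Proof.
elim: n k l => [|n IH] k l cc.
  have [f [fb fa fd]] : giso (and_prod (unit_pgraph R) (mixed_pow G1 G2 k l))
                             (mixed_pow G1 G2 k l).
    exact: giso_sym (giso_trans (giso_and_unit _) (giso_andC _ _)).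
  exists (@c k l \o f) => [u v uv|F].
    by apply: cc => //; move: uv; rewrite !adj_adjeq fa (inj_eq (bij_inj fb)).
  exact: (sum_giso (fun v => F (@c k l v)) fb fd).
have [|d1 d1c d1E] := IH k.+1 l; first by move=> k' l' E; apply: cc; lia.
have [|d2 d2c d2E] := IH k l.+1; first by move=> k' l' E; apply: cc; lia.
have [f [fb fa fd]] := giso_split ha G1 G2 n k l.
pose d (u : vertex (disj_union ha
    (and_prod (gpow (disj_union ha G1 G2) n) (mixed_pow G1 G2 k.+1 l))
    (and_prod (gpow (disj_union ha G1 G2) n) (mixed_pow G1 G2 k l.+1)))) :=
  match u with inl v => d1 v | inr v => d2 v end.
have dc : coloring d by move=> [u|u] [v|v] //; [exact: d1c|exact: d2c].
exists (d \o f) => [u v uv|F].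
  by apply: dc; move: uv; rewrite !adj_adjeq fa (inj_eq (bij_inj fb)).
rewrite [LHS](sum_giso (fun v => F (d v)) fb fd).
by rewrite sum_disj_union d1E d2E.
Qed.

(* Gibbs' inequality is applied with the uniform average [r] of the color laws
   of the [n + 1] types, which dominates each of them up to the factor [n + 1]. *)
Lemma chromatic_entropy_le_bexp (R : realType) (a : R) (ha : 0 < a < 1)
    (G1 G2 : pgraph R) n :
  chromatic_entropy (gpow (disj_union ha G1 G2) n) <=
  log2 n.+1%:R + bexp a n (mixed_entropy G1 G2) 0 0.
Proof.
apply/ler_addgt0Pr => e e0.
have mP : forall k : nat, exists m : nat, (0 < m)%N /\
    forall l M, (k + l = n)%N -> (m <= M)%N ->
    exists2 c : vertex (mixed_pow G1 G2 k l) -> 'I_M,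
      coloring c & entropy (law c) < mixed_entropy G1 G2 k l + e.
  move=> k; have [m m0 Hm] := near_optimal_coloring (mixed_pow G1 G2 k (n - k)) e0.
  exists m; split => // l M kl mM.
  have -> : l = (n - k)%N by lia.
  exact: Hm.
have {mP}[m Hm] := choice mP.
(* One palette large enough for all types [(k, n - k)]. *)
pose M := (\max_(k < n.+1) m k)%N.
have mM k : (k <= n)%N -> (m k <= M)%N.
  by move=> kn; exact: (@leq_bigmax _ (fun k : 'I_n.+1 => m k) (Ordinal (kn : k < n.+1)%N)).
have M0 : (0 < M)%N by rewrite (leq_trans _ (mM 0%N _))//; case: (Hm 0%N).
have cP : forall p : nat * nat,
    exists c : vertex (mixed_pow G1 G2 p.1 p.2) -> 'I_M, (p.1 + p.2 = n)%N ->
      coloring c /\ entropy (law c) < mixed_entropy G1 G2 p.1 p.2 + e.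
  move=> [k l]/=; have [kl|kl] := eqVneq (k + l)%N n; last first.
    (* Off the antidiagonal a constant map serves as default. *)
    by exists (fun _ => Ordinal M0) => E; rewrite E eqxx in kl.
  have [_ /(_ l M kl)[|d dc dH]] := Hm k; first by apply: mM; lia.
  by exists d.
have [c Hc] : exists c : forall p, vertex (mixed_pow G1 G2 p.1 p.2) -> 'I_M,
    forall p, (p.1 + p.2 = n)%N ->
      coloring (c p) /\ entropy (law (c p)) < mixed_entropy G1 G2 p.1 p.2 + e.
  by exists (fun p => sval (cid (cP p))) => p; exact: svalP (cid (cP p)).
have [|d dc dE] := @mixture_coloring R a ha G1 G2 'I_M n 0 0 (fun k l => c (k, l)).
  by move=> k l E; have [] := Hc (k, l); first by rewrite E !addn0.
have n0 : 0 < n.+1%:R :> R by rewrite ltr0n.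
pose r (t : 'I_M) : R := n.+1%:R^-1 * \sum_(k < n.+1) law (c (k : nat, (n - k)%N)) t.
have rge k l t : (k + l = n)%N -> law (c (k, l)) t <= n.+1%:R * r t.
  move=> E; rewrite /r mulrA divff ?gt_eqF// mul1r.
  have kn : (k < n.+1)%N by lia.
  have -> : l = (n - k)%N by lia.
  rewrite (bigD1 (Ordinal kn))//= lerDl.
  by apply: sumr_ge0 => i _; exact: law_ge0.
have r0 t : 0 <= r t.
  by rewrite mulr_ge0 ?invr_ge0 ?ler0n// sumr_ge0// => i _; exact: law_ge0.
have giso0 : giso (gpow (disj_union ha G1 G2) n)
    (and_prod (gpow (disj_union ha G1 G2) n) (mixed_pow G1 G2 0 0)).
  apply: giso_trans (giso_and_unit _) _; apply: giso_and (giso_refl _) _.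
  exact: giso_and_unit.
rewrite (chromatic_entropy_giso giso0).
apply: (le_trans (chromatic_entropy_le dc)).
apply: (@le_trans _ _ (- \sum_x law d x * log2 (r x))).
  apply: gibbs => //; first by move=> x; exact: law_ge0.
    rewrite sum_law /r -mulr_sumr exchange_big/=.
    under eq_bigr do rewrite sum_law.
    by rewrite sumr_const card_ord mulVf ?gt_eqF.
  (* A color of [r]-weight 0 is null for every type, hence for the mixture. *)
  move=> t rt; rewrite law_indicator (dE (fun x => (x == t)%:R)).
  rewrite -[RHS](bexp_cst a 0 n 0 0); apply: eq_bexp => k l E.
  rewrite -law_indicator; apply/eqP; rewrite eq_le law_ge0 andbT.
  by apply: (le_trans (rge k l t _)); [lia|rewrite rt mulr0].
rewrite sum_law_mul (dE (fun x => log2 (r x))) -mulN1r -bexpZ.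
(* The constants are moved inside the expectation, so that the comparison is made one type at a
   time. *)
have -> : log2 n.+1%:R + bexp a n (mixed_entropy G1 G2) 0 0 + e =
    bexp a n (fun k l => (log2 n.+1%:R + mixed_entropy G1 G2 k l) + e) 0 0.
  by rewrite !bexpD !bexp_cst.
apply: (ler_bexp ha) => k l E; have kl : (k + l = n)%N by lia.
have [_ /ltW H] := Hc (k, l) kl.
rewrite -addrA; apply: le_trans (lerD (lexx _) H).
rewrite entropy_law mulN1r lerNl opprB.
have -> : log2 n.+1%:R = \sum_(v : vertex (mixed_pow G1 G2 k l)) dist v * log2 n.+1%:R.
  by rewrite -mulr_suml dist_sum1 mul1r.
rewrite -sumrB.
apply: ler_sum => v _; rewrite -mulrBr.
have [->|v0] := eqVneq (dist v) 0; first by rewrite !mul0r.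
apply: ler_wpM2l; first exact: dist_ge0.
have lv0 : 0 < law (c (k, l)) (c (k, l) v).
  by apply: lt_le_trans (dist_le_law _ _); rewrite lt_neqAle eq_sym v0 dist_ge0.
have rv0 : 0 < r (c (k, l) v).
  by rewrite -(pmulr_rgt0 _ n0); apply: lt_le_trans (rge k l _ kl).
rewrite lerBlDl -log2M//.
by apply: ler_log2 => //; exact: rge.
Qed.

Lemma giso_mixed_pow00 (R : realType) (G1 G2 H : pgraph R) :
  giso H (and_prod H (mixed_pow G1 G2 0 0)).
Proof.
apply: giso_trans (giso_and_unit _) _; apply: giso_and (giso_refl _) _.
exact: giso_and_unit.
Qed.

(** * Linear growth rates and Fekete's lemma *)

(** Encodes that the limsup of [u n / n] is at most [c]. The additive constant makes the bound hold
    at every index, so it can be averaged over a random index that may be small. *)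
Definition linear_le (R : realType) (u : nat -> R) (c : R) : Prop :=
  forall e, 0 < e -> exists C, forall n, u n <= (c + e) * n%:R + C.

(** A positive gap between the slopes, times a large [n], would exceed the constant. The
    inequalities between complementary entropies are all derived this way. *)
Lemma linear_le_lower (R : realType) (u : nat -> R) (L c : R) :
  (forall n, L * n%:R <= u n) -> linear_le u c -> L <= c.
Proof.
move=> Lu uc; apply/ler_addgt0Pr => e e0; rewrite leNgt; apply/negP => cL.
have [C HC] := uc _ e0.
have d0 : 0 < L - (c + e) by rewrite subr_gt0.
have := archi_boundP (normr_ge0 (C / (L - (c + e)))).
set n := Num.bound _ => Hn.
have : (L - (c + e)) * n%:R <= C.
  by rewrite mulrBl lerBlDl; apply: le_trans (Lu n) (HC n).
rewrite leNgt => /negP; apply.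
rewrite mulrC -ltr_pdivrMr//.
exact: le_lt_trans (ler_norm _) Hn.
Qed.

Lemma fekete (R : realType) (u : nat -> R) :
  (forall n, 0 <= u n) -> (forall m n, u (m + n)%N <= u m + u n) ->
  exists L, [/\ (fun n : nat => u n / n%:R) @ \oo --> L,
    linear_le u L & forall n, L * n%:R <= u n].
Proof.
(* The shift of the index keeps the default value of [u 0 / 0] out of the infimum. *)
move=> u0 uD; pose A := [set x | exists n, x = u n.+1 / n.+1%:R].
have A0 : lbound A 0 by move=> _ [n ->]; rewrite divr_ge0.
have Ainf : has_inf A by split; [exists (u 1%N / 1), 0%N|exists 0].
have L0 : 0 <= inf A by apply: lb_le_inf => //; case: Ainf.
have Lu n : inf A * n%:R <= u n.
  case: n => [|n]; first by rewrite mulr0.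
  by rewrite -ler_pdivlMr ?ltr0n//; apply: ge_inf; [exists 0|exists n].
have ulin : linear_le u (inf A).
  move=> e e0; have [_ [N ->] HN] := inf_adherent e0 Ainf.
  (* Divide [n] by [N.+1]: the sum over all residues bounds the contribution of the remainder. *)
  exists (\sum_(r < N.+1) u r) => n.
  have uM q r : u (q * N.+1 + r)%N <= q%:R * u N.+1 + u r.
    elim: q => [|q IH]; first by rewrite mul0r add0r.
    rewrite mulSn -addnA; apply: (le_trans (uD _ _)).
    by rewrite -natr1; lra.
  rewrite {1}(divn_eq n N.+1); apply: (le_trans (uM _ _)); apply: lerD.
    apply: (@le_trans _ _ ((inf A + e) * (n %/ N.+1 * N.+1)%:R)).
      rewrite natrM mulrCA ler_wpM2l//; move: HN.
      by rewrite ltr_pdivrMr ?ltr0n// => /ltW.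
    by rewrite ler_wpM2l ?addr_ge0 ?(ltW e0)// ler_nat leq_divM.
  have nN : (n %% N.+1 < N.+1)%N by rewrite ltn_mod.
  by rewrite (bigD1 (Ordinal nN))//= lerDl sumr_ge0.
exists (inf A); split => //.
apply/cvgrPdist_le => e e0.
have e20 : 0 < e / 2 by rewrite divr_gt0.
have [C HC] := ulin _ e20.
(* From this index on, [C / n] is at most [e / 2]. *)
exists (Num.bound `|C / (e / 2)|).+1 => //= n /= Hn.
have n0 : 0 < n%:R :> R by rewrite ltr0n (leq_trans _ Hn).
have Cn : C <= e / 2 * n%:R.
  rewrite mulrC -ler_pdivrMr//.
  apply: (le_trans (ler_norm _)).
  apply: (le_trans (ltW (archi_boundP (normr_ge0 _)))).
  by rewrite ler_nat ltnW.
rewrite distrC ger0_norm ?subr_ge0 ?ler_pdivlMr//.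
rewrite lerBlDl ler_pdivrMr//.
apply: (le_trans (HC n)).
lra.
Qed.

(** Apply [ln y <= y - 1] at [y = n.+1 * (e * ln 2)], which gives slope exactly [e]. *)
Lemma log2_le_linear (R : realType) (e : R) : 0 < e ->
  exists C, forall n : nat, log2 n.+1%:R <= e * n%:R + C.
Proof.
move=> e0; have d0 : 0 < e * ln 2 by rewrite mulr_gt0 ?ln2_gt0.
exists (e + (- 1 - ln (e * ln 2)) / ln 2) => n.
rewrite /log2 ler_pdivrMr ?ln2_gt0// [leRHS]mulrDl [in X in _ + X]mulrDl divfK ?gt_eqF ?ln2_gt0//.
have n0 : 0 < n.+1%:R :> R by rewrite ltr0n.
have := @le_ln1Dx R (n.+1%:R * (e * ln 2) - 1).
rewrite (addrC 1) subrK lnM ?posrE//.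
rewrite ltrBrDr addNr mulr_gt0// -natr1 => /(_ isT).
lra.
Qed.

Lemma gpow_entropyD (R : realType) (G : pgraph R) m n :
  chromatic_entropy (gpow G (m + n)) <=
  chromatic_entropy (gpow G m) + chromatic_entropy (gpow G n).
Proof.
rewrite (chromatic_entropy_giso (giso_gpowD G m n)).
exact: chromatic_entropy_and.
Qed.

(** Fekete's lemma identifies the limit; later proofs use only these two bounds. *)
Lemma compl_entropyP (R : realType) (G : pgraph R) :
  linear_le (fun n => chromatic_entropy (gpow G n)) (compl_entropy G) /\
  forall n, compl_entropy G * n%:R <= chromatic_entropy (gpow G n).
Proof.
have [L [Lu uL Lle]] := fekete (fun n => chromatic_entropy_ge0 (gpow G n))
  (gpow_entropyD G).
suff -> : compl_entropy G = L by [].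
rewrite /compl_entropy.
have -> : (fun n : nat => chromatic_entropy (and_pow G n) / n%:R) =
          (fun n : nat => chromatic_entropy (gpow G n) / n%:R).
  (* At [n = 0] both quotients are 0 by the convention on division by zero. *)
  apply/funext => -[|n]; first by rewrite !invr0 !mulr0.
  by rewrite (chromatic_entropy_giso (giso_and_pow G n)).
exact/cvg_lim.
Qed.

(** * Inequalities between the complementary entropies *)

Section MixedBounds.
Variables (R : realType) (G1 G2 : pgraph R) (a : R) (ha : 0 < a < 1).

Local Notation h := (mixed_entropy G1 G2).
Local Notation A := (compl_entropy G1).
Local Notation B := (compl_entropy G2).
Local Notation S := (compl_entropy (and_prod G1 G2)).
Local Notation U := (compl_entropy (disj_union ha G1 G2)).
Local Notation uU n := (chromatic_entropy (gpow (disj_union ha G1 G2) n)).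

Lemma mixed_entropy_k0 k : h k 0 = chromatic_entropy (gpow G1 k).
Proof. by rewrite (chromatic_entropy_giso (giso_mixed_pow0 G1 G2 k)). Qed.

Lemma mixed_entropy_0l l : h 0 l = chromatic_entropy (gpow G2 l).
Proof. by rewrite (chromatic_entropy_giso (giso_mixed_0pow G1 G2 l)). Qed.

Lemma mixed_entropy_diag n :
  h n n = chromatic_entropy (gpow (and_prod G1 G2) n).
Proof. by rewrite (chromatic_entropy_giso (giso_gpow_and G1 G2 n)). Qed.

Lemma mixed_entropy_le_fst_snd k l : h k l <= h k 0 + h 0 l.
Proof. by have := mixed_entropyD G1 G2 k 0 0 l; rewrite addn0. Qed.

Lemma compl_entropy_and_le : S <= A + B.
Proof.
have [_ Sle] := compl_entropyP (and_prod G1 G2).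
have [uA _] := compl_entropyP G1; have [uB _] := compl_entropyP G2.
apply: (linear_le_lower Sle) => e e0.
have e20 : 0 < e / 2 by rewrite divr_gt0.
have [CA HA] := uA _ e20; have [CB HB] := uB _ e20.
exists (CA + CB) => n; rewrite -mixed_entropy_diag.
apply: (le_trans (mixed_entropy_le_fst_snd n n)).
rewrite mixed_entropy_k0 mixed_entropy_0l.
apply: (le_trans (lerD (HA n) (HB n))).
lra.
Qed.

Lemma compl_entropy_and_le_union : S <= U + (1 - a) * A + a * B.
Proof.
have [_ Sle] := compl_entropyP (and_prod G1 G2).
have [uA _] := compl_entropyP G1; have [uB _] := compl_entropyP G2.
have [uUl _] := compl_entropyP (disj_union ha G1 G2).
apply: (linear_le_lower Sle) => e e0.
have e20 : 0 < e / 2 by rewrite divr_gt0.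
have [CA HA] := uA _ e20; have [CB HB] := uB _ e20; have [C HC] := uUl _ e20.
exists (C + CA + CB) => n; rewrite -mixed_entropy_diag.
(* The constant [h n n] is its own expectation; each outcome [(k, l)] splits one exponent as [k + l]
   and the other as [l + k]. *)
apply: (@le_trans _ _ (bexp a n (fun k l => h k l +
   (((A + e / 2) * l%:R + CA) + ((B + e / 2) * k%:R + CB))) 0 0)).
  rewrite -[leLHS](bexp_cst a _ n 0 0); apply: (ler_bexp ha) => k l E.
  have {1}-> : n = (k + l)%N by lia.
  have -> : n = (l + k)%N by lia.
  apply: (le_trans (mixed_entropyD G1 G2 k l l k)); rewrite lerD2l.
  apply: (le_trans (mixed_entropy_le_fst_snd l k)).
  by rewrite mixed_entropy_k0 mixed_entropy_0l lerD.
rewrite !bexpD !bexpZ !bexp_cst bexp_fst bexp_snd !add0r.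
have Hn : bexp a n h 0 0 <= uU n.
  rewrite (chromatic_entropy_giso (giso_mixed_pow00 G1 G2 _)).
  exact: bexp_le_chromatic_entropy.
have := HC n.
lra.
Qed.

Lemma compl_entropy_union_le :
  U <= a * A + (1 - a) * B - (A + B - S) * (a * (1 - a)).
Proof.
have /andP[a0 a1] := ha.
have [uS _] := compl_entropyP (and_prod G1 G2).
have [uA _] := compl_entropyP G1; have [uB _] := compl_entropyP G2.
have [_ Ule] := compl_entropyP (disj_union ha G1 G2).
apply: (linear_le_lower Ule) => e e0.
have e20 : 0 < e / 2 by rewrite divr_gt0.
have [CA HA] := uA _ e20; have [CB HB] := uB _ e20; have [CS HS] := uS _ e20.
have [C HC] := log2_le_linear e20.
pose D := A + B - S.
have D0 : 0 <= D by rewrite subr_ge0 compl_entropy_and_le.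
have ab0 : 0 <= D * (a * (1 - a)) by rewrite !mulr_ge0// ?(ltW a0)// subr_ge0 ltW.
(* The last term arises because the mean of [K * (n - K)] is [n * (n - 1) * a * (1 - a)], with
   [n - 1] in place of [n]. *)
exists (C + CA + CB + CS + D * (a * (1 - a))) => n.
apply: (le_trans (chromatic_entropy_le_bexp ha G1 G2 n)).
(* The diagonal part saves [D] per unit of [m]. Weakening [m] to [k * l / n] leaves a polynomial in
   [k] and [l], whose expectation is explicit. *)
have hle k l : (k + l = n)%N -> h k l <=
    A * k%:R + B * l%:R + (- D / n%:R) * (k%:R * l%:R)
    + (e / 2 * n%:R + (CA + CB + CS)).
  move=> E; pose m := minn k l.
  have Hm : h k l <= h m m + (h (k - m)%N 0 + h 0 (l - m)%N).
    have -> : h k l = h (m + (k - m))%N (m + (l - m))%N.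
      by congr (h _ _); rewrite /m; lia.
    apply: (le_trans (mixed_entropyD G1 G2 _ _ _ _)); rewrite lerD2l.
    exact: mixed_entropy_le_fst_snd.
  apply: (le_trans Hm).
  rewrite mixed_entropy_k0 mixed_entropy_0l mixed_entropy_diag.
  apply: (le_trans (lerD (HS m) (lerD (HA _) (HB _)))).
  have mk : (m <= k)%N by exact: geq_minl.
  have ml : (m <= l)%N by exact: geq_minr.
  rewrite !natrB//.
  (* The product [k * l] is the minimum times the maximum, and the maximum is at most [n]. *)
  have mn : D / n%:R * (k%:R * l%:R) <= D * m%:R.
    rewrite -mulrA ler_wpM2l// mulrC.
    have [n0|n0] := posnP n.
      by rewrite n0 invr0 mulr0.
    rewrite ler_pdivrMr ?ltr0n// -!natrM ler_nat -E /m.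
    by case: (leqP k l) => kl; nia.
  (* The three slacks add up to [e / 2 * (n - m)], to be bounded by [e / 2 * n]. *)
  have me : 0 <= e / 2 * m%:R by rewrite mulr_ge0// ltW.
  have nE : n%:R = k%:R + l%:R :> R by rewrite -E natrD.
  rewrite [in X in _ <= _ + (X + _)]nE /D in mn *; lra.
have := ler_bexp ha (fun k l E => hle k l (etrans E (etrans (addn0 _) (addn0 _)))).
rewrite !bexpD !bexpZ !bexp_cst bexp_fst bexp_snd bexp_mul !add0r => H.
have := HC n.
have Dn : - D / n%:R * (n%:R * a * (n%:R * (1 - a)) - n%:R * a * (1 - a)) <=
    - D * (a * (1 - a)) * n%:R + D * (a * (1 - a)).
  (* At [n = 0] the left side vanishes by the division convention and the right side is nonnegative
     by [ab0]. *)
  have [->|n0] := posnP n; first by rewrite invr0 !mulr0 !mul0r add0r.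
  rewrite le_eqVlt; apply/orP; left; apply/eqP; field.
  by rewrite pnatr_eq0 -lt0n.
rewrite -/D; lra.
Qed.

End MixedBounds.

Theorem mainTheorem4 (R : realType) (G1 G2 : pgraph R) (a : R)
    (ha : 0 < a < 1) :
  compl_entropy (disj_union ha G1 G2) =
    a * compl_entropy G1 + (1 - a) * compl_entropy G2
  <->
  compl_entropy (and_prod G1 G2) = compl_entropy G1 + compl_entropy G2.
Proof.
have /andP[a0 a1] := ha.
have H1 := compl_entropy_and_le G1 G2.
have H2 := compl_entropy_and_le_union G1 G2 ha.
have H3 := compl_entropy_union_le G1 G2 ha.
have ab0 : 0 < a * (1 - a) by rewrite mulr_gt0// subr_gt0.
split => E.
  (* With equality for the union, [H3] makes the deficit of the product, times [a * (1 - a)],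
     nonpositive. *)
  apply/eqP; rewrite eq_le H1/= -subr_le0 -(pmulr_lle0 _ ab0).
  by rewrite E in H3; lra.
(* Without a deficit, [H3] is the upper bound for the union and [H2] rearranges to the matching
   lower bound. *)
by rewrite E in H2 H3; apply/eqP; rewrite eq_le; apply/andP; split; lra.
Qed.
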